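(* Let $\rho: l\to r\Leftarrow s_1\twoheadrightarrow t_1;\dots;s_k\twoheadrightarrow t_k$ be an extended deterministic conditional rewrite rule, and for $1\le i\le k$ let $X_i=\mathrm{Var}(l,t_1,\dots,t_{i-1})$. Then: (1) $\rho$ is $\mathbb{U}$-LL iff all of $l,t_1,\dots,t_k$ are linear and $\mathrm{Var}(t_i)\cap X_i=\emptyset$ for all $1\le i\le k$; (2) $\rho$ is $\mathbb{U}$-RL iff $r$ is linear and all of $s_1,\dots,s_k$ are ground; (3) $\rho$ is $\mathbb{U}$-NE iff $\mathrm{Var}(l,t_1,\dots,t_k)\subseteq\mathrm{Var}(r)$.
   Context: $\mathrm{Var}(t_1,\dots,t_n)$ is the set of variables occurring in the terms; a term is linear if no variable occurs twice, ground if it has no variables. An extended conditional rewrite rule $l\to r\Leftarrow s_1\twoheadrightarrow t_1;\dots;s_k\twoheadrightarrow t_k$ ($k\ge0$; $l$ may be a variable) is deterministic if $\mathrm{Var}(s_i)\subseteq\mathrm{Var}(l,t_1,\dots,t_{i-1})$ for all $i$. An unconditional rule $l\to r$ is LL if $l$ is linear, RL if $r$ is linear, NE if $\mathrm{Var}(l)\subseteq\mathrm{Var}(r)$. Ohlebusch's unraveling of $\rho$ with $k\ge1$: with $\overrightarrow{X}$ the list of the elements of a finite variable set $X$ in a fixed order (without repetition) and fresh function symbols $U^\rho_1,\dots,U^\rho_k$: $\mathbb{U}(\rho)=\{l\to U^\rho_1(s_1,\overrightarrow{X_1})\}\cup\{U^\rho_i(t_i,\overrightarrow{X_i})\to U^\rho_{i+1}(s_{i+1},\overrightarrow{X_{i+1}})\mid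 1\le i<k\}\cup\{U^\rho_k(t_k,\overrightarrow{X_k})\to r\}$; for $k=0$, $\mathbb{U}(\rho)=\{l\to r\}$. For a property P of unconditional rules, $\rho$ is $\mathbb{U}$-P if every rule in $\mathbb{U}(\rho)$ has P. *)

(* Defs.v *)
From mathcomp Require Import all_boot finmap.

Set Implicit Arguments.
Unset Strict Implicit.
Unset Printing Implicit Defensive.

Local Open Scope fset_scope.

Record signature := Signature { symbol : Type; arity : symbol -> nat }.

Inductive term (S : signature) (V : Type) : Type :=
| TVar of V
| TApp (f : symbol S) of {ffun 'I_(arity f) -> term S V}.

Arguments TVar {S V}.
Arguments TApp {S V}.

Definition tapp (S : signature) (V : Type) (f : symbol S)
    (a : (arity f).-tuple (term S V)) : term S V :=
  TApp f [ffun j => tnth a j].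

(* The variable occurrences of a term, from left to right. *)
Fixpoint occs (S : signature) (V : Type) (t : term S V) : seq V :=
  match t with
  | TVar x => [:: x]
  | TApp f a => flatten [seq occs (a j) | j <- enum 'I_(arity f)]
  end.

Definition Vars (S : signature) (V : choiceType) (ts : seq (term S V)) :
    {fset V} :=
  [fset x in flatten [seq occs t | t <- ts]].

Definition linear (S : signature) (V : choiceType) (t : term S V) : bool :=
  uniq (occs t).

Definition ground (S : signature) (V : choiceType) (t : term S V) : Prop :=
  Vars [:: t] = fset0.

Record rule (S : signature) (V : Type) :=
  Rule { lhs : term S V; rhs : term S V }.

Definition LL (S : signature) (V : choiceType) (R : rule S V) : Prop :=
  linear (lhs R).

Definition RL (S : signature) (V : choiceType) (R : rule S V) : Prop :=
  linear (rhs R).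

Definition NE (S : signature) (V : choiceType) (R : rule S V) : Prop :=
  Vars [:: lhs R] `<=` Vars [:: rhs R].

(* l -> r <= s_1 ->> t_1; ...; s_k ->> t_k, extended: l may be a variable and  *)
(* r may contain arbitrary variables. The conditions are numbered from 0, so   *)
(* csrc rho i and ctgt rho i are the terms usually written s_(i+1), t_(i+1).   *)
Record crule (S : signature) (V : Type) := CRule {
  clhs : term S V;
  crhs : term S V;
  ncond : nat;
  conds : ncond.-tuple (term S V * term S V) }.

Definition csrc (S : signature) (V : Type) (rho : crule S V)
    (i : 'I_(ncond rho)) : term S V :=
  (tnth (conds rho) i).1.

Definition ctgt (S : signature) (V : Type) (rho : crule S V)
    (i : 'I_(ncond rho)) : term S V :=
  (tnth (conds rho) i).2.

(* Variables of l and of the targets of the conditions preceding condition i. *)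
Definition Xvars (S : signature) (V : choiceType) (rho : crule S V)
    (i : 'I_(ncond rho)) : {fset V} :=
  Vars (clhs rho :: take i [seq c.2 | c <- conds rho]).

Definition deterministic (S : signature) (V : choiceType) (rho : crule S V) :
    Prop :=
  forall i : 'I_(ncond rho), Vars [:: csrc i] `<=` Xvars i.

(* A choice, for each finite set of variables, of a fixed order in which to    *)
(* list its elements.                                                          *)
Record varorder (V : choiceType) := VarOrder {
  listing : forall X : {fset V}, (#|` X|).-tuple V;
  listing_uniq : forall X, uniq (listing X);
  listing_mem : forall X, listing X =i X }.

Definition enum_varorder (V : choiceType) : varorder V :=
  @VarOrder V (fun X => in_tuple (enum_fset X))
    (fun X => fset_uniq X) (fun X x => erefl).

(* S extended with a fresh symbol for each condition of rho; the symbol takes  *)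
(* one term followed by the list of the variables in Xvars i.                  *)
Definition Uarity (S : signature) (V : choiceType) (rho : crule S V)
    (f : symbol S + 'I_(ncond rho)) : nat :=
  match f with
  | inl g => arity g
  | inr i => (#|` Xvars i|).+1
  end.

Definition Usig (S : signature) (V : choiceType) (rho : crule S V) :
    signature :=
  Signature (@Uarity S V rho).

Fixpoint embed (S : signature) (V : choiceType) (rho : crule S V)
    (t : term S V) : term (Usig rho) V :=
  match t with
  | TVar x => TVar x
  | TApp f a => @TApp (Usig rho) V (inl f) [ffun j => embed rho (a j)]
  end.

Definition Uterm (S : signature) (V : choiceType) (o : varorder V)
    (rho : crule S V) (i : 'I_(ncond rho)) (u : term S V) :
    term (Usig rho) V :=
  @tapp (Usig rho) V (inr i)
    [tuple of embed rho u :: map TVar (listing o (Xvars i))].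

Inductive unravel (S : signature) (V : choiceType) (o : varorder V)
    (rho : crule S V) : rule (Usig rho) V -> Prop :=
| unravel_uncond :
    ncond rho = 0 ->
    unravel o (Rule (embed rho (clhs rho)) (embed rho (crhs rho)))
| unravel_first (i : 'I_(ncond rho)) :
    i = 0 :> nat ->
    unravel o (Rule (embed rho (clhs rho)) (Uterm o i (csrc i)))
| unravel_mid (i j : 'I_(ncond rho)) :
    j = i.+1 :> nat ->
    unravel o (Rule (Uterm o i (ctgt i)) (Uterm o j (csrc j)))
| unravel_last (i : 'I_(ncond rho)) :
    i.+1 = ncond rho ->
    unravel o (Rule (Uterm o i (ctgt i)) (embed rho (crhs rho))).

(* rho is U-P, for the unraveling determined by the variable order o. *)
Definition Uhas (S : signature) (V : choiceType) (o : varorder V)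
    (rho : crule S V) (P : rule (Usig rho) V -> Prop) : Prop :=
  forall R, unravel o R -> P R.

Arguments Uhas {S V} o rho P.

(* Main.v *)
Require Import Defs.
From mathcomp Require Import all_boot finmap.

Set Implicit Arguments.
Unset Strict Implicit.
Unset Printing Implicit Defensive.

Local Open Scope fset_scope.

(** The term U_i(u, X_i), here [Uterm o i u], has the occurrences of [u] followed by each variable
    of X_i exactly once ([occs_Uterm]). So it is linear iff [u] is linear and shares no variable
    with X_i ([linear_Uterm]). The left-hand sides of the unraveling are l and the U_i(t_i, X_i),
    which gives the LL claim. The right-hand sides are r and the U_i(s_i, X_i); determinism puts
    Var(s_i) inside X_i, so linearity forces s_i to be ground ([linear_Uterm_ground]), which gives
    the RL claim. For NE, X_(i+1) is the union of Var(t_i) and X_i ([XvarsS]), so the variable sets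
    telescope along the chain of rules, and the rule leading to r has exactly Var(l, t_1, ..., t_k)
    on its left. *)

Lemma mem_Vars (S : signature) (V : choiceType) (ts : seq (term S V)) (x : V) :
  (x \in Vars ts) = has (fun t => x \in occs t) ts.
Proof.
by rewrite inE /=; elim: ts => //= t ts IH; rewrite mem_cat IH.
Qed.

Lemma mem_Vars1 (S : signature) (V : choiceType) (t : term S V) (x : V) :
  (x \in Vars [:: t]) = (x \in occs t).
Proof. by rewrite mem_Vars /= orbF. Qed.

Lemma ground_linear (S : signature) (V : choiceType) (t : term S V) :
  ground t -> linear t.
Proof.
rewrite /ground /linear => gt; have := mem_Vars1 t; rewrite gt.
by case: (occs t) => // x s /(_ x); rewrite in_fset0 mem_head.
Qed.

Lemma occs_tapp (S : signature) (V : Type) (f : symbol S)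
    (a : (arity f).-tuple (term S V)) :
  occs (tapp a) = flatten [seq occs t | t <- a].
Proof.
rewrite -[in RHS](map_tnth_enum a) -map_comp /=; congr flatten.
by apply: eq_map => j /=; rewrite ffunE.
Qed.

Lemma occs_embed (S : signature) (V : choiceType) (rho : crule S V)
    (t : term S V) :
  occs (embed rho t) = occs t.
Proof.
(* The arguments sit inside a finite function, so an explicit fixpoint supplies the induction
   hypothesis for them. *)
move: t; fix IH 1 => -[x|f a] //=; congr flatten.
by apply: eq_map => j; rewrite ffunE; apply: IH.
Qed.

Section Unraveling.

Context {S : signature} {V : choiceType} (o : varorder V) (rho : crule S V).

Implicit Types (i j : 'I_(ncond rho)) (u t : term S V) (x : V).

Lemma linear_embed t : linear (embed rho t) = linear t.
Proof. by rewrite /linear occs_embed. Qed.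

Lemma Vars_embed t : Vars [:: embed rho t] = Vars [:: t].
Proof. by apply/fsetP=> x; rewrite !mem_Vars1 occs_embed. Qed.

Lemma occs_Uterm i u : occs (Uterm o i u) = occs u ++ listing o (Xvars i).
Proof.
rewrite occs_tapp /= occs_embed -map_comp; congr (_ ++ _).
by elim: (tval _) => //= x s ->.
Qed.

Lemma Vars_Uterm i u : Vars [:: Uterm o i u] = Vars [:: u] `|` Xvars i.
Proof.
apply/fsetP=> x.
by rewrite in_fsetU !mem_Vars1 occs_Uterm mem_cat listing_mem.
Qed.

Lemma linear_Uterm i u :
  linear (Uterm o i u) <-> linear u /\ Vars [:: u] `&` Xvars i = fset0.
Proof.
rewrite /linear occs_Uterm cat_uniq listing_uniq andbT; split.
  case/andP=> -> dis; split=> //; apply/fsetP=> x.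
  rewrite in_fsetI mem_Vars1 in_fset0; apply/negP=> /andP[xu xX].
  by case/hasP: dis; exists x; rewrite ?listing_mem.
case=> -> dis; apply/hasPn=> x; rewrite listing_mem => xX; apply/negP=> xu.
by have := in_fset0 x; rewrite -dis in_fsetI mem_Vars1 xX [x \in _]xu.
Qed.

(** Every variable of [u] recurs in the list of X_i, so a single one already breaks linearity. *)
Lemma linear_Uterm_ground i u :
  Vars [:: u] `<=` Xvars i -> linear (Uterm o i u) <-> ground u.
Proof.
move=> uX; split=> [/linear_Uterm[_]|gu]; first by rewrite (fsetIidPl uX).
by apply/linear_Uterm; split; [apply: ground_linear|rewrite gu fset0I].
Qed.

Lemma Vars_Uterm_sub i u :
  Vars [:: u] `<=` Xvars i -> Vars [:: Uterm o i u] = Xvars i.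
Proof. by rewrite Vars_Uterm => /fsetUidPr. Qed.

Lemma Xvars0 i : i = 0 :> nat -> Xvars i = Vars [:: clhs rho].
Proof. by rewrite /Xvars => ->; rewrite take0. Qed.

(** Stated with [take i.+1] rather than X_(i+1), so that it also covers the last condition, which
    has no successor index. *)
Lemma Vars_take_ctgt i :
  Vars (clhs rho :: take i.+1 [seq c.2 | c <- conds rho]) =
    Vars [:: ctgt i] `|` Xvars i.
Proof.
apply/fsetP=> x; rewrite in_fsetU mem_Vars1 !mem_Vars.
(* There may be no closed term to serve as a default, so condition [i] itself provides the default
   values. *)
rewrite (take_nth (ctgt i)) ?size_map ?size_tuple ?ltn_ord //.
rewrite -rcons_cons has_rcons (nth_map (csrc i, ctgt i)) ?size_tuple ?ltn_ord //.
by rewrite -tnth_nth.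
Qed.

Lemma XvarsS i j :
  j = i.+1 :> nat -> Xvars j = Vars [:: ctgt i] `|` Xvars i.
Proof. by rewrite -Vars_take_ctgt /Xvars => ->. Qed.

Lemma Vars_conds_last i :
  i.+1 = ncond rho ->
  Vars (clhs rho :: [seq c.2 | c <- conds rho]) =
    Vars [:: ctgt i] `|` Xvars i.
Proof.
by move=> ik; rewrite -Vars_take_ctgt take_oversize ?size_map ?size_tuple ?ik.
Qed.

Lemma Vars_conds0 :
  ncond rho = 0 ->
  Vars (clhs rho :: [seq c.2 | c <- conds rho]) = Vars [:: clhs rho].
Proof.
by move=> k0; rewrite [map _ _]size0nil // size_map size_tuple.
Qed.

(** This lemma and the next three serve the forward implications: each term to be constrained is
    exhibited as a side of some rule. LL and RL look at one side only, so the other may stay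
    existential; NE needs both sides of the rule leading to r. *)
Lemma unravel_from_clhs :
  exists r, unravel o (Rule (embed rho (clhs rho)) r).
Proof.
case: (posnP (ncond rho)) => [k0|k_gt0].
  by exists (embed rho (crhs rho)); apply: unravel_uncond.
by exists (Uterm o (Ordinal k_gt0) (csrc (Ordinal k_gt0))); apply: unravel_first.
Qed.

Lemma unravel_from_ctgt i :
  exists r, unravel o (Rule (Uterm o i (ctgt i)) r).
Proof.
case: (ltnP i.+1 (ncond rho)) => [lt_ik|le_ki].
  by exists (Uterm o (Ordinal lt_ik) (csrc (Ordinal lt_ik))); apply: unravel_mid.
exists (embed rho (crhs rho)); apply: unravel_last.
by apply/eqP; rewrite eqn_leq le_ki ltn_ord.
Qed.

Lemma unravel_to_crhs :
  (ncond rho = 0 /\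
     unravel o (Rule (embed rho (clhs rho)) (embed rho (crhs rho)))) \/
  exists2 i : 'I_(ncond rho), i.+1 = ncond rho &
    unravel o (Rule (Uterm o i (ctgt i)) (embed rho (crhs rho))).
Proof.
case: (posnP (ncond rho)) => [k0|k_gt0].
  by left; split=> //; apply: unravel_uncond.
have lt_k : (ncond rho).-1 < ncond rho by rewrite prednK.
right; exists (Ordinal lt_k); first by rewrite /= prednK.
by apply: unravel_last; rewrite /= prednK.
Qed.

Lemma unravel_to_csrc i :
  exists l, unravel o (Rule l (Uterm o i (csrc i))).
Proof.
case: (posnP i) => [i0|i_gt0].
  by exists (embed rho (clhs rho)); apply: unravel_first.
have lt_i : i.-1 < ncond rho by apply: leq_ltn_trans (leq_pred i) (ltn_ord i).
exists (Uterm o (Ordinal lt_i) (ctgt (Ordinal lt_i))).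
by apply: unravel_mid; rewrite /= prednK.
Qed.

End Unraveling.

Theorem theorem3p9 (S : signature) (V : choiceType) (o : varorder V)
    (rho : crule S V) (rho_det : deterministic rho) :
  [/\ Uhas o rho (@LL _ V) <->
        (linear (clhs rho) /\
         (forall i : 'I_(ncond rho), linear (ctgt i)) /\
         (forall i : 'I_(ncond rho),
            Vars [:: ctgt i] `&` Xvars i = fset0)),
      Uhas o rho (@RL _ V) <->
        (linear (crhs rho) /\
         (forall i : 'I_(ncond rho), ground (csrc i))) &
      Uhas o rho (@NE _ V) <->
        Vars (clhs rho :: [seq c.2 | c <- conds rho]) `<=`
          Vars [:: crhs rho] ].
Proof.
split.
- split=> [H|[lin_l [lin_t dis_t]] _ [_|i _|i j _|i _]]; rewrite /LL /=.
  + have lin_U (i : 'I_(ncond rho)) : linear (Uterm o i (ctgt i)).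
      by have [r /H] := unravel_from_ctgt o i.
    split; first by have [r /H] := unravel_from_clhs o rho; rewrite /LL linear_embed.
    by split=> i; have /linear_Uterm[] := lin_U i.
  + by rewrite linear_embed.
  + by rewrite linear_embed.
  + by apply/linear_Uterm.
  + by apply/linear_Uterm.
- split=> [H|[lin_r gr_s] _ [_|i _|i j _|i _]]; rewrite /RL /=.
  + split.
      by have [[_ /H]|[i _ /H]] := unravel_to_crhs o rho; rewrite /RL linear_embed.
    (* Determinism turns linearity of U_i(s_i, X_i) into groundness of s_i. *)
    move=> i; apply/(linear_Uterm_ground o (rho_det i)).
    by have [l /H] := unravel_to_csrc o i.
  + by rewrite linear_embed.
  + exact/(linear_Uterm_ground o (rho_det i)).
  + exact/(linear_Uterm_ground o (rho_det j)).
  + by rewrite linear_embed.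
(* Determinism makes the right-hand side of every rule but the last contain
   exactly the variables of its left-hand side, so only the last rule matters. *)
- split=> [H|sub_r _ [k0|i i0|i j ij|i ik]]; rewrite /NE /=.
  + have [[k0 /H]|[i ik /H]] := unravel_to_crhs o rho; rewrite /NE /= !Vars_embed.
      by rewrite Vars_conds0.
    by rewrite Vars_Uterm (Vars_conds_last ik).
  + by rewrite !Vars_embed -Vars_conds0.
  + by rewrite Vars_embed Vars_Uterm_sub // Xvars0.
  + by rewrite Vars_Uterm (Vars_Uterm_sub o (rho_det j)) (XvarsS ij).
  + by rewrite Vars_Uterm Vars_embed -Vars_conds_last.
Qed.
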